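(* Let $0<|q|<1$, $0<|p|<1$, $|x|<1$, $|y|<1$. (I) Let $a,b,c,d\in\mathbb{C}$ with $p^{c}\neq p^{-n}$ and $q^{d}\ne q^{-n}$ for all integers $n\ge 0$. If $q^{a}\neq 1$ then $$\Psi_{1}(q^{a+1},p^{b};p^{c},q^{d};q,p,x,y)=\Psi_{1}(q^{a},p^{b};p^{c},q^{d};q,p,x,y)+\frac{q^{a}x}{1-q^{d}}\Psi_{1}(q^{a+1},p^{b};p^{c},q^{d+1};q,p,x,y)$$ $$\qquad+\frac{q^{a}}{1-q^{a}}\Psi_{1}(q^{a},p^{b};p^{c},q^{d};q,p,qx,y)-\frac{q^{a}}{1-q^{a}}\Psi_{1}(q^{a},p^{b};p^{c},q^{d};q,p,qx,qy)$$ and $$\Psi_{1}(q^{a+1},p^{b};p^{c},q^{d};q,p,x,y)=\frac{1}{1-q^{a}}\Psi_{1}(q^{a},p^{b};p^{c},q^{d};q,p,x,y)-\frac{q^{a}}{1-q^{a}}\Psi_{1}(q^{a},p^{b};p^{c},q^{d};q,p,x,qy)$$ $$\qquad+\frac{q^{a}x}{1-q^{d}}\Psi_{1}(q^{a+1},p^{b};p^{c},q^{d+1};q,p,x,qy).$$ If $q^{d-1}\neq 1$ then $$\Psi_{1}(q^{a},p^{b};p^{c},q^{d-1};q,p,x,y)=\Psi_{1}(q^{a},p^{b};p^{c},q^{d};q,p,x,y)+\frac{q^{d-1}(1-q^{a})x}{(1-q^{d-1})(1-q^{d})}\Psi_{1}(q^{a+1},p^{b};p^{c},q^{d+1};q,p,x,y).$$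 (II) Let $a,b,c\in\mathbb{C}$ with $p^{b}\neq p^{-n}$ and $q^{c}\ne q^{-n}$ for all integers $n\ge 0$. If $q^{a}\neq 1$ then $$\Psi_{2}(q^{a+1};p^{b},q^{c};q,p,x,y)=\Psi_{2}(q^{a};p^{b},q^{c};q,p,x,y)+\frac{q^{a}x}{1-q^{c}}\Psi_{2}(q^{a+1};p^{b},q^{c+1};q,p,x,y)$$ $$\qquad+\frac{q^{a}}{1-q^{a}}\Psi_{2}(q^{a};p^{b},q^{c};q,p,qx,y)-\frac{q^{a}}{1-q^{a}}\Psi_{2}(q^{a};p^{b},q^{c};q,p,qx,qy)$$ and $$\Psi_{2}(q^{a+1};p^{b},q^{c};q,p,x,y)=\frac{1}{1-q^{a}}\Psi_{2}(q^{a};p^{b},q^{c};q,p,x,y)-\frac{q^{a}}{1-q^{a}}\Psi_{2}(q^{a};p^{b},q^{c};q,p,x,qy)$$ $$\qquad+\frac{q^{a}x}{1-q^{c}}\Psi_{2}(q^{a+1};p^{b},q^{c+1};q,p,x,qy).$$ If $q^{c-1}\neq 1$ then $$\Psi_{2}(q^{a};p^{b},q^{c-1};q,p,x,y)=\Psi_{2}(q^{a};p^{b},q^{c};q,p,x,y)+\frac{q^{c-1}(1-q^{a})x}{(1-q^{c-1})(1-q^{c})}\Psi_{2}(q^{a+1};p^{b},q^{c+1};q,p,x,y).$$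
   Context: $q,p\in\mathbb{C}$ are two independent bases with $0<|q|<1$, $0<|p|<1$; logarithms of $q$ and $p$ are fixed so that $q^{a}=e^{a\log q}$, $p^{b}=e^{b\log p}$ for complex exponents. The $q$-shifted factorial is $(A;q)_{0}=1$, $(A;q)_{k}=\prod_{r=0}^{k-1}(1-Aq^{r})$ for $k\ge1$ (similarly with base $p$). The bibasic Humbert functions are, for $|x|,|y|<1$ and whenever no denominator factor vanishes, $$\Psi_{1}(q^{a},p^{b};p^{c},q^{d};q,p,x,y)=\sum_{\ell,k=0}^{\infty}\frac{(q^{a};q)_{k+\ell}(p^{b};p)_{\ell}}{(p^{c};p)_{\ell}(q^{d};q)_{k}(q;q)_{k}(p;p)_{\ell}}x^{k}y^{\ell},$$ $$\Psi_{2}(q^{a};p^{b},q^{c};q,p,x,y)=\sum_{\ell,k=0}^{\infty}\frac{(q^{a};q)_{k+\ell}}{(p^{b};p)_{\ell}(q^{c};q)_{k}(q;q)_{k}(p;p)_{\ell}}x^{k}y^{\ell}.$$ *)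

(* Defs.v *)
From Stdlib Require Import Reals.
From Coquelicot Require Import Coquelicot.
Open Scope C_scope.

Definition Cexp (z : C) : C :=
  (exp (Re z) * cos (Im z), exp (Re z) * sin (Im z))%R.

(* The complex power base^a, where [logbase] is the chosen logarithm of base. *)
Definition cpower (logbase a : C) : C := Cexp (a * logbase).

(* The shifted factorial (A;q)_k. *)
Fixpoint qpoch (A q : C) (k : nat) : C :=
  match k with
  | O => 1
  | S r => qpoch A q r * (1 - A * q ^ r)
  end.

(* Rectangular partial sums: all u l k with l <= fst N and k <= snd N. *)
Definition dsum (u : nat -> nat -> C) (N : nat * nat) : C :=
  sum_n (fun l => sum_n (fun k => u l k) (snd N)) (fst N).

(* Sum of a double series: limit of the rectangular partial sums as both bounds
   tend to infinity independently. *)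
Definition is_dseries (u : nat -> nat -> C) (s : C) : Prop :=
  filterlim (dsum u) (filter_prod eventually eventually) (locally s).

(* Total version of [is_dseries]; meaningful for convergent double series only,
   see [is_dseries_unique]. *)
Definition dseries (u : nat -> nat -> C) : C :=
  lim (T := C_CompleteNormedModule)
    (filtermap (dsum u) (filter_prod eventually eventually)).

Lemma is_dseries_unique (u : nat -> nat -> C) (s : C) :
  is_dseries u s -> dseries u = s.
Proof.
intros H.
assert (PF : ProperFilter (filtermap (dsum u) (filter_prod eventually eventually))).
{ apply filtermap_proper_filter, filter_prod_proper. }
apply (eq_close (K := C_AbsRing) (V := C_NormedModule)).
apply (filterlim_locally_close (F := filter_prod eventually eventually) (dsum u)); [|exact H].
intros P [e He].
assert (Hc : cauchy (T := C_CompleteNormedModule)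
  (filtermap (dsum u) (filter_prod eventually eventually))).
{ intros eps; exists s; apply H; exists eps; intros y Hy; exact Hy. }
generalize (complete_cauchy (T := C_CompleteNormedModule) _ PF Hc e).
apply filter_imp; exact He.
Qed.

(* Arguments: A = q^a, B = p^b, Cc = p^c, D = q^d. *)
Definition Psi1 (A B Cc D q p x y : C) : C :=
  dseries (fun l k =>
    qpoch A q (k + l) * qpoch B p l
    / (qpoch Cc p l * qpoch D q k * qpoch q q k * qpoch p p l)
    * x ^ k * y ^ l).

(* Arguments: A = q^a, B = p^b, Cc = q^c. *)
Definition Psi2 (A B Cc q p x y : C) : C :=
  dseries (fun l k =>
    qpoch A q (k + l)
    / (qpoch B p l * qpoch Cc q k * qpoch q q k * qpoch p p l)
    * x ^ k * y ^ l).

(* Main.v *)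
Require Import Defs.
From Stdlib Require Import Reals Lra Lia FunctionalExtensionality.
From Coquelicot Require Import Coquelicot.
Open Scope C_scope.

(* All the identities hold coefficientwise. Raising A = q^a to qA multiplies the (l,k)
   coefficient by (1 - A q^(k+l)) / (1 - A), and one splits
     1 - A q^(k+l) = (1 - A) + A (1 - q^k) + A (q^k - q^(k+l))
                   = (1 - A q^l) + A q^l (1 - q^k);
   likewise passing from q^d = q D to D multiplies it by
     (1 - D q^k) / (1 - D) = 1 + D (1 - q^k) / (1 - D).
   Powers q^k and q^l rescale x and y, while a factor 1 - q^k cancels the last factor of
   (q;q)_k and, after k -> k + 1, produces the series with parameters (q A, q D).
   Summing is legitimate because the shifted factorials and their inverses are bounded,
   so the general term is O(|x|^k |y|^l) and the rectangular sums converge.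
   Psi2 is Psi1 with p^b replaced by 0. *)

(** * Geometric domination of rectangular partial sums *)

Lemma Cmult_eq_reg_l (c z w : C) : c <> 0 -> c * z = c * w -> z = w.
Proof.
intros Hc H.
replace z with (/ c * (c * z)) by (field; exact Hc).
rewrite H; field; exact Hc.
Qed.

Lemma Cminus_diag_uniq (z w : C) : z - w = 0 -> z = w.
Proof.
intros H; replace z with (z - w + w) by ring.
rewrite H; apply Cplus_0_l.
Qed.

Lemma dsum_S_l (u : nat -> nat -> C) (a b : nat) :
  dsum u (S a, b) = dsum u (a, b) + sum_n (fun k => u (S a) k) b.
Proof. unfold dsum; simpl fst; simpl snd; rewrite sum_Sn; reflexivity. Qed.

Lemma dsum_S_r (u : nat -> nat -> C) (a b : nat) :
  dsum u (a, S b) = dsum u (a, b) + sum_n (fun l => u l (S b)) a.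
Proof.
unfold dsum; simpl fst; simpl snd.
rewrite (sum_n_ext _ (fun l => plus (sum_n (fun k => u l k) b) (u l (S b)))).
- rewrite sum_n_plus; reflexivity.
- intros l; apply sum_Sn.
Qed.

(** The geometric sum [1 + r + ... + r^n] in closed form, from which its bound and its limit can be
    read off. *)
Definition geom (r : R) (n : nat) : R := ((1 - r ^ S n) / (1 - r))%R.

Lemma geom_bounds (r : R) (n : nat) :
  (0 <= r < 1)%R -> (0 <= geom r n <= / (1 - r))%R.
Proof.
intros Hr.
assert (0 <= r ^ S n <= 1)%R.
{ split; [apply pow_le; lra|].
  rewrite <- (pow1 (S n)); apply pow_incr; lra. }
assert (0 < / (1 - r))%R by (apply Rinv_0_lt_compat; lra).
unfold geom, Rdiv; split; nra.
Qed.

Lemma geom_S (r : R) (n : nat) :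
  (0 <= r < 1)%R -> geom r (S n) = (geom r n + r ^ S n)%R.
Proof. intros Hr; unfold geom; simpl; field; lra. Qed.

Lemma is_lim_seq_geom_sum (r : R) :
  (0 <= r < 1)%R -> is_lim_seq (geom r) (/ (1 - r))%R.
Proof.
intros Hr.
replace (/ (1 - r))%R with ((1 - 0) * / (1 - r))%R by ring.
apply (is_lim_seq_mult' (fun n => 1 - r ^ S n)%R (fun _ => / (1 - r))%R).
- apply (is_lim_seq_minus' (fun _ => 1%R) (fun n => r ^ S n)%R).
  + apply is_lim_seq_const.
  + apply (is_lim_seq_incr_1 (fun n => r ^ n)%R), is_lim_seq_geom.
    rewrite Rabs_pos_eq; lra.
- apply is_lim_seq_const.
Qed.

Lemma sum_n_geom_bound (v : nat -> C) (K r : R) (n : nat) :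
  (0 <= r < 1)%R -> (forall k, Cmod (v k) <= K * r ^ k)%R ->
  (Cmod (sum_n v n) <= K * geom r n)%R.
Proof.
intros Hr Hv; induction n as [|n IH].
- rewrite sum_O; eapply Rle_trans; [apply Hv|].
  apply Req_le; unfold geom; simpl; field; lra.
- rewrite sum_Sn, geom_S by exact Hr.
  eapply Rle_trans; [apply Cmod_triangle|].
  specialize (Hv (S n)); lra.
Qed.

(** The ratio [r] belongs to the inner index [k] (powers of [x]) and [s] to the outer index [l]
    (powers of [y]). *)
Definition geom_dominated (u : nat -> nat -> C) (r s : R) : Prop :=
  exists M : R, forall l k, (Cmod (u l k) <= M * r ^ k * s ^ l)%R.

Lemma Cmod_minus_trans (x y z : C) (d e : R) :
  (Cmod (x - y) <= d -> Cmod (z - x) <= e -> Cmod (z - y) <= d + e)%R.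
Proof.
intros H1 H2; replace (z - y) with ((z - x) + (x - y)) by ring.
eapply Rle_trans; [apply Cmod_triangle|lra].
Qed.

Lemma Cplus_minus_cancel_l (x y : C) : x + y - x = y.
Proof. ring. Qed.

(** The added terms are majorized by those of [M r^k s^l], whose rectangular sums factor as
    [M * geom s a * geom r b]. The rectangle grows one line at a time, first in [k], then in [l]. *)
Lemma dsum_diff_bound (u : nat -> nat -> C) (M r s : R) (a b i j : nat) :
  (0 <= r < 1)%R -> (0 <= s < 1)%R ->
  (forall l k, Cmod (u l k) <= M * r ^ k * s ^ l)%R ->
  (Cmod (dsum u (i + a, j + b)%nat - dsum u (a, b))
   <= M * (geom s (i + a) * geom r (j + b) - geom s a * geom r b))%R.
Proof.
intros Hr Hs Hu.
assert (Hj : (Cmod (dsum u (a, j + b)%nat - dsum u (a, b))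
   <= M * (geom s a * geom r (j + b) - geom s a * geom r b))%R).
{ induction j as [|j IH].
  - rewrite Nat.add_0_l; replace (dsum u (a, b) - dsum u (a, b)) with (RtoC 0) by ring.
    rewrite Cmod_0; lra.
  - rewrite Nat.add_succ_l, dsum_S_r, geom_S by exact Hr.
    replace (M * _)%R with
      (M * (geom s a * geom r (j + b) - geom s a * geom r b)
       + (M * r ^ S (j + b)) * geom s a)%R by ring.
    apply (Cmod_minus_trans _ _ _ _ _ IH).
    rewrite Cplus_minus_cancel_l.
    apply sum_n_geom_bound; [exact Hs|]; intros l; apply Hu. }
induction i as [|i IH]; [exact Hj|].
rewrite Nat.add_succ_l, dsum_S_l, geom_S by exact Hs.
replace (M * _)%R with
  (M * (geom s (i + a) * geom r (j + b) - geom s a * geom r b)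
   + (M * s ^ S (i + a)) * geom r (j + b))%R by ring.
apply (Cmod_minus_trans _ _ _ _ _ IH).
rewrite Cplus_minus_cancel_l.
apply sum_n_geom_bound; [exact Hr|]; intros k.
eapply Rle_trans; [apply Hu|]; apply Req_le; ring.
Qed.

(** The rectangular sums of the majorant converge to [M / ((1 - s) (1 - r))], so those of [u] are
    Cauchy; completeness then makes the total [lim] in [dseries] a genuine limit. *)
Lemma geom_dominated_is_dseries (u : nat -> nat -> C) (r s : R) :
  (0 <= r < 1)%R -> (0 <= s < 1)%R -> geom_dominated u r s ->
  is_dseries u (dseries u).
Proof.
intros Hr Hs [M Hu].
assert (PF : ProperFilter (filtermap (dsum u) (filter_prod eventually eventually))).
{ apply filtermap_proper_filter, filter_prod_proper. }
assert (HM : (0 <= M)%R).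
{ specialize (Hu O O); simpl in Hu; generalize (Cmod_ge_0 (u O O)); lra. }
assert (Hc : cauchy (T := C_CompleteNormedModule)
  (filtermap (dsum u) (filter_prod eventually eventually))).
{ intros eps.
  assert (Hlim : is_lim_seq (fun n => M * (geom s n * geom r n))%R
                   (M * (/ (1 - s) * / (1 - r)))%R).
  { apply (is_lim_seq_scal_l (fun n => geom s n * geom r n)%R M
            (/ (1 - s) * / (1 - r))%R).
    apply is_lim_seq_mult'; apply is_lim_seq_geom_sum; assumption. }
  (* Outside the [n]-th square the majorant has less than [eps] left, so [dsum u (n, n)] can serve
     as the centre of the Cauchy ball. *)
  destruct (proj2 (is_lim_seq_spec _ _) Hlim eps) as [n Hn].
  specialize (Hn n (le_n n)).
  exists (dsum u (n, n)).
  exists (fun i => (n <= i)%nat) (fun j => (n <= j)%nat);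
    [exists n; trivial | exists n; trivial |].
  intros i j Hi Hj.
  apply (norm_compat1 (V := C_NormedModule)).
  change (Cmod (dsum u (i, j) - dsum u (n, n)) < eps)%R.
  replace i with (i - n + n)%nat by lia.
  replace j with (j - n + n)%nat by lia.
  eapply Rle_lt_trans; [apply (dsum_diff_bound u M r s); assumption|].
  apply Rabs_def2 in Hn.
  pose proof (geom_bounds s (i - n + n) Hs).
  pose proof (geom_bounds r (j - n + n) Hr).
  assert (geom s (i - n + n) * geom r (j - n + n) <= / (1 - s) * / (1 - r))%R.
  { apply Rmult_le_compat; lra. }
  nra. }
intros P [e He].
generalize (complete_cauchy (T := C_CompleteNormedModule) _ PF Hc e).
apply filter_imp; exact He.
Qed.

(** * Linearity and index shift of double series *)

Lemma dsum_plus (u v : nat -> nat -> C) (N : nat * nat) :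
  dsum (fun l k => u l k + v l k) N = dsum u N + dsum v N.
Proof.
unfold dsum.
rewrite (sum_n_ext _ (fun l => plus (sum_n (u l) (snd N)) (sum_n (v l) (snd N)))).
- apply (sum_n_plus (G := C_AbelianMonoid)).
- intros l; apply (sum_n_plus (G := C_AbelianMonoid)).
Qed.

Lemma dsum_scal (c : C) (u : nat -> nat -> C) (N : nat * nat) :
  dsum (fun l k => c * u l k) N = c * dsum u N.
Proof.
unfold dsum.
rewrite (sum_n_ext _ (fun l => scal c (sum_n (u l) (snd N)))).
- apply (sum_n_scal_l (K := C_Ring) (V := C_ModuleSpace)).
- intros l; apply (sum_n_scal_l (K := C_Ring) (V := C_ModuleSpace)).
Qed.

Lemma is_dseries_plus (u v : nat -> nat -> C) (s t : C) :
  is_dseries u s -> is_dseries v t ->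
  is_dseries (fun l k => u l k + v l k) (s + t).
Proof.
intros Hu Hv.
apply filterlim_ext with (fun N => dsum u N + dsum v N).
{ intros N; symmetry; apply dsum_plus. }
apply (filterlim_comp_2 (dsum u) (dsum v) Cplus Hu Hv).
apply (filterlim_plus (V := C_NormedModule) s t).
Qed.

Lemma is_dseries_scal (c : C) (u : nat -> nat -> C) (s : C) :
  is_dseries u s -> is_dseries (fun l k => c * u l k) (c * s).
Proof.
intros Hu.
apply filterlim_ext with (fun N => c * dsum u N).
{ intros N; symmetry; apply dsum_scal. }
apply (filterlim_comp _ _ _ (dsum u) (Cmult c) _ _ _ Hu).
apply (filterlim_scal_r (V := C_NormedModule) c s).
Qed.

Lemma is_dseries_ext (u v : nat -> nat -> C) (s : C) :
  (forall l k, u l k = v l k) -> is_dseries u s -> is_dseries v s.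
Proof.
intros H; apply filterlim_ext.
intros N; apply sum_n_ext; intros l; apply sum_n_ext; intros k; apply H.
Qed.

Lemma is_dseries_minus (u v : nat -> nat -> C) (s t : C) :
  is_dseries u s -> is_dseries v t ->
  is_dseries (fun l k => u l k - v l k) (s - t).
Proof.
intros Hu Hv.
apply (is_dseries_ext (fun l k => u l k + (- (1)) * v l k)); [intros; ring|].
replace (s - t) with (s + (- (1)) * t) by ring.
apply is_dseries_plus, is_dseries_scal; assumption.
Qed.

(** Realizes the reindexing k -> k + 1 without changing the sum. The zero at [k = 0] matches the
    vanishing of [1 - q^k] there. *)
Definition shift_k (u : nat -> nat -> C) (l k : nat) : C :=
  match k with O => 0 | S k => u l k end.

Lemma dsum_shift_k (u : nat -> nat -> C) (a b : nat) :
  dsum (shift_k u) (a, S b) = dsum u (a, b).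
Proof.
unfold dsum; simpl fst; simpl snd.
apply sum_n_ext; intros l.
induction b as [|b IH].
- rewrite sum_Sn, !sum_O; apply (plus_zero_l (G := C_AbelianMonoid)).
- rewrite sum_Sn, IH, sum_Sn; reflexivity.
Qed.

Lemma is_dseries_shift_k (u : nat -> nat -> C) (s : C) :
  is_dseries u s -> is_dseries (shift_k u) s.
Proof.
intros Hu P HP.
destruct (Hu P HP) as [Q1 Q2 H1 [n H2] H].
(* The threshold moves to [S n] because the rectangle [(a, S b)] of the shifted series corresponds
   to [(a, b)] of [u]. *)
exists Q1 (fun b => (S n <= b)%nat); [exact H1 | exists (S n); trivial |].
intros a [|b] Ha Hb; [lia|].
rewrite dsum_shift_k; apply H; [exact Ha | apply H2; lia].
Qed.

(** * Boundedness of shifted factorials and of their inverses *)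

(* The weights [exp (K t^n / (1 - t))] absorb the factors [1 + K t^n <= exp (K t^n)]
   because [t^n / (1 - t) = t^n + t^(n+1) / (1 - t)]. *)
Lemma bounded_of_ratio (v : nat -> R) (K t : R) (N : nat) :
  (0 <= K)%R -> (0 < t < 1)%R -> (forall n, 0 <= v n)%R ->
  (forall n, (N <= n)%nat -> v (S n) <= v n * (1 + K * t ^ n))%R ->
  exists M : R, forall n, (v n <= M)%R.
Proof.
intros HK Ht Hv H.
set (w := fun n => (v n * exp (K * t ^ n / (1 - t)))%R).
assert (Hw : forall n, (v n <= w n)%R).
{ intros n; unfold w.
  assert (1 <= exp (K * t ^ n / (1 - t)))%R.
  { eapply Rle_trans; [|apply exp_ineq1_le].
    assert (0 <= t ^ n)%R by (apply pow_le; lra).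
    assert (0 < / (1 - t))%R by (apply Rinv_0_lt_compat; lra).
    assert (0 <= K * t ^ n)%R by nra.
    unfold Rdiv; nra. }
  specialize (Hv n); nra. }
assert (Hdec : forall i, (w (N + i)%nat <= w N)%R).
{ induction i as [|i IH]; [rewrite Nat.add_0_r; lra|].
  eapply Rle_trans; [|exact IH].
  rewrite Nat.add_succ_r; set (n := (N + i)%nat); unfold w.
  replace (K * t ^ n / (1 - t))%R with (K * t ^ n + K * t ^ S n / (1 - t))%R
    by (simpl; field; lra).
  rewrite exp_plus, <- Rmult_assoc.
  apply Rmult_le_compat_r; [left; apply exp_pos|].
  eapply Rle_trans; [apply H; unfold n; lia|].
  apply Rmult_le_compat_l; [apply Hv|apply exp_ineq1_le]. }
assert (Hfin : exists M, forall n, (n <= N)%nat -> (v n <= M)%R).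
{ clear -v; induction N as [|N [M HM]].
  - exists (v O); intros n Hn; replace n with O by lia; lra.
  - exists (Rmax M (v (S N))); intros n Hn.
    destruct (Nat.eq_dec n (S N)) as [->|Hne]; [apply Rmax_r|].
    eapply Rle_trans; [apply HM; lia|apply Rmax_l]. }
destruct Hfin as [M HM].
exists (Rmax M (w N)); intros n.
destruct (Nat.le_gt_cases n N) as [Hn|Hn].
- eapply Rle_trans; [apply HM, Hn|apply Rmax_l].
- eapply Rle_trans; [|apply Rmax_r].
  eapply Rle_trans; [apply Hw|].
  replace n with (N + (n - N))%nat by lia; apply Hdec.
Qed.

(** Each new factor satisfies [|1 - A q^n| <= 1 + |A| |q|^n], so the ratio criterion applies from
    [n = 0] on. *)
Lemma qpoch_bounded (A q : C) :
  (0 < Cmod q < 1)%R -> exists M : R, forall n, (Cmod (qpoch A q n) <= M)%R.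
Proof.
intros Hq.
apply (bounded_of_ratio _ (Cmod A) (Cmod q) 0); trivial.
- apply Cmod_ge_0.
- intros n; apply Cmod_ge_0.
- intros n _; simpl; rewrite Cmod_mult.
  apply Rmult_le_compat_l; [apply Cmod_ge_0|].
  unfold Cminus; eapply Rle_trans; [apply Cmod_triangle|].
  rewrite Cmod_1, Cmod_opp, Cmod_mult, Cmod_pow; lra.
Qed.

Lemma qpoch_neq_0 (A q : C) (n : nat) :
  (forall m, 1 - A * q ^ m <> 0) -> qpoch A q n <> 0.
Proof.
intros H; induction n as [|n IH]; simpl.
- apply C1_nz.
- apply Cmult_neq_0; [exact IH | apply H].
Qed.

(** For [0 <= t <= 1/2] one has [1 / (1 - t) <= 1 + 2 t]. With [t = |A| |q|^n] this gives the ratio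
    criterion with constant [2 |A|] for large [n]. *)
Lemma inv_qpoch_bounded (A q : C) :
  (0 < Cmod q < 1)%R -> (forall m, 1 - A * q ^ m <> 0) ->
  exists M : R, forall n, (Cmod (/ qpoch A q n) <= M)%R.
Proof.
intros Hq H.
assert (Hlim : is_lim_seq (fun n => Cmod A * Cmod q ^ n)%R (Cmod A * 0)%R).
{ apply (is_lim_seq_scal_l (fun n => Cmod q ^ n)%R (Cmod A) 0%R), is_lim_seq_geom.
  rewrite Rabs_pos_eq; lra. }
rewrite Rmult_0_r in Hlim.
(* [N] is chosen so that [|A| |q|^n < 1/2] for all [n >= N]. *)
destruct (proj2 (is_lim_seq_spec _ _) Hlim (mkposreal (/ 2) ltac:(lra)))
  as [N HN]; simpl in HN.
apply (bounded_of_ratio _ (2 * Cmod A) (Cmod q) N); trivial.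
- generalize (Cmod_ge_0 A); lra.
- intros n; apply Cmod_ge_0.
- intros n Hn; simpl.
  specialize (HN n Hn); apply Rabs_def2 in HN.
  rewrite !Cmod_inv, Cmod_mult; [|apply qpoch_neq_0, H | apply Cmult_neq_0; [apply qpoch_neq_0, H|apply H]].
  rewrite Rinv_mult.
  apply Rmult_le_compat_l.
  { left; apply Rinv_0_lt_compat, Cmod_gt_0, qpoch_neq_0, H. }
  assert (Ht : (1 - Cmod A * Cmod q ^ n <= Cmod (1 - A * q ^ n))%R).
  { rewrite <- Cmod_pow, <- Cmod_mult.
    generalize (Cmod_triangle (1 - A * q ^ n) (A * q ^ n)).
    replace (1 - A * q ^ n + A * q ^ n) with (RtoC 1) by ring.
    rewrite Cmod_1; lra. }
  assert (0 <= Cmod A * Cmod q ^ n)%R.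
  { apply Rmult_le_pos; [apply Cmod_ge_0 | apply pow_le; lra]. }
  (* Cleared of the inverse, the claim follows from [1 <= (1 - t) (1 + 2 t)]. *)
  apply (Rmult_le_reg_r (Cmod (1 - A * q ^ n))); [lra|].
  rewrite Rinv_l by lra.
  nra.
Qed.

(** * Convergence of the series defining [Psi1] *)

Definition psi1_term (A B E D q p x y : C) (l k : nat) : C :=
  qpoch A q (k + l) * qpoch B p l
  / (qpoch E p l * qpoch D q k * qpoch q q k * qpoch p p l)
  * x ^ k * y ^ l.

Lemma one_minus_pow_neq_0 (q : C) (m : nat) :
  (0 < Cmod q < 1)%R -> 1 - q * q ^ m <> 0.
Proof.
intros Hq H.
apply Cminus_diag_uniq, (f_equal Cmod) in H.
rewrite <- Cpow_S, Cmod_1, Cmod_pow in H.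
assert (0 <= Cmod q ^ S m < 1)%R by (apply pow_lt_1_compat; [lra|lia]).
lra.
Qed.

Lemma psi1_term_dominated (A B E D q p x y : C) :
  (0 < Cmod q < 1)%R -> (0 < Cmod p < 1)%R ->
  (forall m, 1 - E * p ^ m <> 0) -> (forall m, 1 - D * q ^ m <> 0) ->
  geom_dominated (psi1_term A B E D q p x y) (Cmod x) (Cmod y).
Proof.
intros Hq Hp HE HD.
pose proof (fun m => one_minus_pow_neq_0 q m Hq) as Hqq.
pose proof (fun m => one_minus_pow_neq_0 p m Hp) as Hpp.
destruct (qpoch_bounded A q Hq) as [M1 H1].
destruct (qpoch_bounded B p Hp) as [M2 H2].
destruct (inv_qpoch_bounded E p Hp HE) as [M3 H3].
destruct (inv_qpoch_bounded D q Hq HD) as [M4 H4].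
destruct (inv_qpoch_bounded q q Hq Hqq) as [M5 H5].
destruct (inv_qpoch_bounded p p Hp Hpp) as [M6 H6].
exists (M1 * M2 * (M3 * M4 * M5 * M6))%R; intros l k.
unfold psi1_term.
(* The quotient is split into separate inverses so that the six bounds apply factor by factor. *)
replace (_ / _) with (qpoch A q (k + l) * qpoch B p l
  * (/ qpoch E p l * / qpoch D q k * / qpoch q q k * / qpoch p p l))
  by (field; repeat split; apply qpoch_neq_0; assumption).
rewrite !Cmod_mult, !Cmod_pow.
repeat (apply Rmult_le_compat; [repeat apply Rmult_le_pos; try apply Cmod_ge_0; apply pow_le, Cmod_ge_0 | apply pow_le, Cmod_ge_0 | | apply Rle_refl]).
repeat (apply Rmult_le_compat; [repeat apply Rmult_le_pos; apply Cmod_ge_0 | repeat apply Rmult_le_pos; apply Cmod_ge_0 | | ]); auto.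
Qed.

Lemma is_dseries_Psi1 (A B E D q p x y : C) :
  (0 < Cmod q < 1)%R -> (0 < Cmod p < 1)%R -> (Cmod x < 1)%R -> (Cmod y < 1)%R ->
  (forall m, 1 - E * p ^ m <> 0) -> (forall m, 1 - D * q ^ m <> 0) ->
  is_dseries (psi1_term A B E D q p x y) (Psi1 A B E D q p x y).
Proof.
intros Hq Hp Hx Hy HE HD.
apply (geom_dominated_is_dseries _ (Cmod x) (Cmod y)).
- split; [apply Cmod_ge_0 | exact Hx].
- split; [apply Cmod_ge_0 | exact Hy].
- apply psi1_term_dominated; assumption.
Qed.

(** Reduces a relation to its coefficients: the right-hand side is first assembled as a convergent
    series [u] with sum [s], and only a termwise equality remains. *)
Lemma Psi1_ext (A B E D q p x y s : C) (u : nat -> nat -> C) :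
  is_dseries u s -> (forall l k, psi1_term A B E D q p x y l k = u l k) ->
  Psi1 A B E D q p x y = s.
Proof.
intros Hu H.
apply is_dseries_unique, (is_dseries_ext u); [|exact Hu].
intros l k; symmetry; apply H.
Qed.

(** * Effect of parameter shifts on the coefficients *)

(** Both sides are (A;q)_{n+1}, with the first or the last factor split off. *)
Lemma qpoch_mul_base (A q : C) (n : nat) :
  (1 - A) * qpoch (q * A) q n = qpoch A q n * (1 - A * q ^ n).
Proof.
induction n as [|n IH]; simpl.
- ring.
- rewrite Cmult_assoc, IH; ring.
Qed.

Lemma qpoch_mul_base_S (A q : C) (n : nat) :
  qpoch A q (S n) = (1 - A) * qpoch (q * A) q n.
Proof. rewrite qpoch_mul_base; reflexivity. Qed.

Lemma psi1_term_mul_A (A B E D q p x y : C) (l k : nat) :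
  (1 - A) * psi1_term (q * A) B E D q p x y l k
  = (1 - A * q ^ (k + l)) * psi1_term A B E D q p x y l k.
Proof.
unfold psi1_term, Cdiv; rewrite !Cmult_assoc, qpoch_mul_base; ring.
Qed.

Lemma psi1_term_mul_x (A B E D q p x y : C) (l k : nat) :
  psi1_term A B E D q p (q * x) y l k = q ^ k * psi1_term A B E D q p x y l k.
Proof. unfold psi1_term; rewrite Cpow_mult_l; ring. Qed.

Lemma psi1_term_mul_y (A B E D q p x y : C) (l k : nat) :
  psi1_term A B E D q p x (q * y) l k = q ^ l * psi1_term A B E D q p x y l k.
Proof. unfold psi1_term; rewrite Cpow_mult_l; ring. Qed.

(** The factors for [q * D] are those for [D] from index 1 on. *)
Lemma mul_base_neq_0 (D q : C) :
  (forall m, 1 - D * q ^ m <> 0) -> forall m, 1 - q * D * q ^ m <> 0.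
Proof.
intros H m; replace (q * D * q ^ m) with (D * q ^ S m) by (rewrite Cpow_S; ring).
apply H.
Qed.

(** * Contiguous relations for [Psi1] *)

Section Contiguous.

Variables (A B E D q p x y : C).
Hypotheses (Hq : (0 < Cmod q < 1)%R) (Hp : (0 < Cmod p < 1)%R)
  (Hx : (Cmod x < 1)%R) (Hy : (Cmod y < 1)%R)
  (HE : forall m, 1 - E * p ^ m <> 0) (HD : forall m, 1 - D * q ^ m <> 0).

Lemma one_minus_D_neq_0 : 1 - D <> 0.
Proof. generalize (HD 0); simpl; rewrite Cmult_1_r; trivial. Qed.

(** At [k = 0] both sides vanish. At [S k], splitting off the first factors of (A;q) and (D;q)
    produces the parameters [q * A] and [q * D], while [1 - q^(k+1)] cancels the last factor of
    (q;q). The argument [y'] is left free because both [y] and [q * y] occur. *)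
Lemma shift_psi1_term (y' : C) (l k : nat) :
  (1 - A) * x / (1 - D) * shift_k (psi1_term (q * A) B E (q * D) q p x y') l k
  = (1 - q ^ k) * psi1_term A B E D q p x y' l k.
Proof.
pose proof one_minus_D_neq_0 as HD0.
destruct k as [|k]; [simpl; ring|].
simpl shift_k; unfold psi1_term.
rewrite Nat.add_succ_l, !(qpoch_mul_base_S A), !(qpoch_mul_base_S D).
simpl qpoch; rewrite !Cpow_S.
assert (Hqq := fun m => one_minus_pow_neq_0 q m Hq).
assert (Hpp := fun m => one_minus_pow_neq_0 p m Hp).
field; repeat split; trivial; try (apply qpoch_neq_0; trivial).
apply mul_base_neq_0, HD.
Qed.

Lemma Cmod_mul_base_lt (z : C) : (Cmod z < 1)%R -> (Cmod (q * z) < 1)%R.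
Proof.
intros Hz; rewrite Cmod_mult; generalize (Cmod_ge_0 z); nra.
Qed.

Lemma Psi1_raise_A_1 :
  1 - A <> 0 ->
  Psi1 (q * A) B E D q p x y
  = Psi1 A B E D q p x y
    + A * x / (1 - D) * Psi1 (q * A) B E (q * D) q p x y
    + A / (1 - A) * Psi1 A B E D q p (q * x) y
    - A / (1 - A) * Psi1 A B E D q p (q * x) (q * y).
Proof.
intros HA; pose proof one_minus_D_neq_0 as HD0.
eapply Psi1_ext.
(* The combination mirrors the right-hand side, so unification determines the series [u], with the
   term in [q * D] shifted in [k]. *)
- refine (is_dseries_minus _ _ _ _ (is_dseries_plus _ _ _ _ (is_dseries_plus _ _ _ _ _
    (is_dseries_scal _ _ _ (is_dseries_shift_k _ _ _)))
    (is_dseries_scal _ _ _ _)) (is_dseries_scal _ _ _ _));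
    apply is_dseries_Psi1; auto using Cmod_mul_base_lt, mul_base_neq_0.
- intros l k; simpl.
  rewrite !psi1_term_mul_x, psi1_term_mul_y.
  (* This exposes the prefactor of [shift_psi1_term]. *)
  replace (A * x / (1 - D)) with (A / (1 - A) * ((1 - A) * x / (1 - D)))
    by (field; auto).
  rewrite <- (Cmult_assoc (A / (1 - A)) ((1 - A) * x / (1 - D))), shift_psi1_term.
  (* Multiplying by [1 - A] reduces the claim to the splitting [1 - A q^(k+l) = (1 - A) + A (1 -
     q^k) + A q^k - A q^k q^l]. *)
  apply (Cmult_eq_reg_l (1 - A) _ _ HA).
  rewrite psi1_term_mul_A, Cpow_add_r; field; exact HA.
Qed.

Lemma Psi1_raise_A_2 :
  1 - A <> 0 ->
  Psi1 (q * A) B E D q p x y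
  = 1 / (1 - A) * Psi1 A B E D q p x y
    - A / (1 - A) * Psi1 A B E D q p x (q * y)
    + A * x / (1 - D) * Psi1 (q * A) B E (q * D) q p x (q * y).
Proof.
intros HA; pose proof one_minus_D_neq_0 as HD0.
eapply Psi1_ext.
- refine (is_dseries_plus _ _ _ _ (is_dseries_minus _ _ _ _ (is_dseries_scal _ _ _ _)
    (is_dseries_scal _ _ _ _)) (is_dseries_scal _ _ _ (is_dseries_shift_k _ _ _)));
    apply is_dseries_Psi1; auto using Cmod_mul_base_lt, mul_base_neq_0.
- intros l k; simpl.
  replace (A * x / (1 - D)) with (A / (1 - A) * ((1 - A) * x / (1 - D)))
    by (field; auto).
  rewrite <- (Cmult_assoc (A / (1 - A)) ((1 - A) * x / (1 - D))), shift_psi1_term.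
  rewrite psi1_term_mul_y.
  (* Here the splitting is [1 - A q^(k+l) = (1 - A q^l) + A q^l (1 - q^k)]. *)
  apply (Cmult_eq_reg_l (1 - A) _ _ HA).
  rewrite psi1_term_mul_A, Cpow_add_r; field; exact HA.
Qed.

End Contiguous.

(** Here [D] plays the role of q^(d-1), so that the other parameters are [q * D] and [q * (q * D)]
    and no division by [q] occurs. *)
Lemma Psi1_lower_D (A B E D q p x y : C) :
  (0 < Cmod q < 1)%R -> (0 < Cmod p < 1)%R -> (Cmod x < 1)%R -> (Cmod y < 1)%R ->
  (forall m, 1 - E * p ^ m <> 0) -> (forall m, 1 - D * q ^ m <> 0) ->
  Psi1 A B E D q p x y
  = Psi1 A B E (q * D) q p x y
    + D * (1 - A) * x / ((1 - D) * (1 - q * D))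
      * Psi1 (q * A) B E (q * (q * D)) q p x y.
Proof.
intros Hq Hp Hx Hy HE HD.
pose proof (one_minus_D_neq_0 D q HD) as HD0.
pose proof (mul_base_neq_0 D q HD) as HqD.
pose proof (one_minus_D_neq_0 (q * D) q HqD) as HD1.
eapply Psi1_ext.
- apply is_dseries_plus; [|apply is_dseries_scal, is_dseries_shift_k];
    apply is_dseries_Psi1; auto using mul_base_neq_0.
- intros l k; simpl.
  replace (D * (1 - A) * x / ((1 - D) * (1 - q * D)))
    with (D / (1 - D) * ((1 - A) * x / (1 - q * D))) by (field; auto).
  (* The shift identity is used with [q * D] in place of [D]. *)
  rewrite <- (Cmult_assoc (D / (1 - D))), shift_psi1_term by assumption.
  assert (Hqq := fun m => one_minus_pow_neq_0 q m Hq).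
  assert (Hpp := fun m => one_minus_pow_neq_0 p m Hp).
  assert (HDk : qpoch D q k * (1 - D * q ^ k) = (1 - D) * qpoch (q * D) q k)
    by (symmetry; apply qpoch_mul_base).
  unfold psi1_term.
  (* With both sides expressed through [qpoch (q * D) q k], what remains is
     [1 - D q^k = (1 - D) + D (1 - q^k)]. *)
  replace (qpoch D q k) with ((1 - D) * qpoch (q * D) q k / (1 - D * q ^ k))
    by (rewrite <- HDk; field; apply HD).
  field; repeat split; trivial; try (apply qpoch_neq_0; trivial).
Qed.

(** * Reduction of [Psi2] to [Psi1] *)

Lemma qpoch_0_l (q : C) (n : nat) : qpoch 0 q n = 1.
Proof. induction n as [|n IH]; simpl; [reflexivity|rewrite IH; ring]. Qed.

(** Since 0 is not of the form p^b, this reduction relies on the relations for [Psi1] holding with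
    arbitrary [B]. *)
Lemma Psi2_Psi1 (A B D q p x y : C) :
  Psi2 A B D q p x y = Psi1 A 0 B D q p x y.
Proof.
unfold Psi1, Psi2; f_equal.
extensionality l; extensionality k.
rewrite qpoch_0_l, Cmult_1_r; reflexivity.
Qed.

(** * Complex powers and nonvanishing denominators *)

Lemma Cexp_plus (z w : C) : Cexp (z + w) = Cexp z * Cexp w.
Proof.
destruct z as [a b], w as [c d]; unfold Cexp; simpl.
rewrite exp_plus, cos_plus, sin_plus.
apply injective_projections; simpl; ring.
Qed.

Lemma Cexp_0 : Cexp 0 = 1.
Proof.
unfold Cexp; simpl; rewrite exp_0, cos_0, sin_0.
apply injective_projections; simpl; ring.
Qed.

Lemma cpower_plus (lg a b : C) : cpower lg (a + b) = cpower lg a * cpower lg b.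
Proof. unfold cpower; rewrite Cmult_plus_distr_r; apply Cexp_plus. Qed.

Lemma cpower_1 (lg : C) : cpower lg 1 = Cexp lg.
Proof. unfold cpower; rewrite Cmult_1_l; reflexivity. Qed.

Lemma cpower_INR (lg : C) (n : nat) : cpower lg (INR n) = Cexp lg ^ n.
Proof.
induction n as [|n IH].
- unfold cpower; simpl; rewrite Cmult_0_l; apply Cexp_0.
- rewrite S_INR, RtoC_plus, cpower_plus, IH, cpower_1, Cpow_S; ring.
Qed.

Lemma cpower_opp_INR (lg : C) (n : nat) : cpower lg (- INR n) * Cexp lg ^ n = 1.
Proof.
rewrite <- cpower_INR, <- cpower_plus.
replace (- INR n + INR n) with (RtoC 0) by ring.
unfold cpower; rewrite Cmult_0_l; apply Cexp_0.
Qed.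

(** If a factor vanished, multiplying by the inverse power [cpower lg (- INR m)] would give an
    excluded value of [cpower lg c]. *)
Lemma cpower_nonsingular (lg c : C) :
  (forall n : nat, cpower lg c <> cpower lg (- INR n)) ->
  forall m, 1 - cpower lg c * Cexp lg ^ m <> 0.
Proof.
intros H m E; apply (H m).
assert (Hm := cpower_opp_INR lg m).
assert (Hz : Cexp lg ^ m <> 0).
{ intros Hz; rewrite Hz, Cmult_0_r in Hm; apply C1_nz; auto. }
apply (Cmult_eq_reg_l _ _ _ Hz).
rewrite !(Cmult_comm (Cexp lg ^ m)), Hm; symmetry; apply Cminus_diag_uniq, E.
Qed.

Lemma one_minus_neq_0 (z : C) : z <> 1 -> 1 - z <> 0.
Proof. intros H; apply Cminus_eq_contra; auto. Qed.

Lemma cpower_plus_1 (lg a : C) : cpower lg (a + 1) = Cexp lg * cpower lg a.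
Proof. rewrite cpower_plus, cpower_1; apply Cmult_comm. Qed.

Lemma cpower_minus_1 (lg a : C) : cpower lg a = Cexp lg * cpower lg (a - 1).
Proof. rewrite <- cpower_plus_1; f_equal; ring. Qed.

(** Lowering d by one adds a single new factor, at [m = 0], which [D <> 1] controls. *)
Lemma lowered_nonsingular (D q : C) :
  D <> 1 -> (forall m, 1 - q * D * q ^ m <> 0) -> forall m, 1 - D * q ^ m <> 0.
Proof.
intros H1 H [|m].
- simpl; rewrite Cmult_1_r; apply one_minus_neq_0, H1.
- rewrite Cpow_S; replace (D * (q * q ^ m)) with (q * D * q ^ m) by ring; apply H.
Qed.

Theorem theorem2p1 :
  forall (q p logq logp x y : C),
  Cexp logq = q -> Cexp logp = p ->
  (0 < Cmod q < 1)%R -> (0 < Cmod p < 1)%R ->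
  (Cmod x < 1)%R -> (Cmod y < 1)%R ->
  (forall a b c d : C,
    (forall n : nat, cpower logp c <> cpower logp (- INR n)) ->
    (forall n : nat, cpower logq d <> cpower logq (- INR n)) ->
    (cpower logq a <> 1 ->
      Psi1 (cpower logq (a + 1)) (cpower logp b) (cpower logp c) (cpower logq d) q p x y
      = Psi1 (cpower logq a) (cpower logp b) (cpower logp c) (cpower logq d) q p x y
        + cpower logq a * x / (1 - cpower logq d)
          * Psi1 (cpower logq (a + 1)) (cpower logp b) (cpower logp c) (cpower logq (d + 1)) q p x y
        + cpower logq a / (1 - cpower logq a)
          * Psi1 (cpower logq a) (cpower logp b) (cpower logp c) (cpower logq d) q p (q * x) y
        - cpower logq a / (1 - cpower logq a)
          * Psi1 (cpower logq a) (cpower logp b) (cpower logp c) (cpower logq d) q p (q * x) (q * y)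
      /\
      Psi1 (cpower logq (a + 1)) (cpower logp b) (cpower logp c) (cpower logq d) q p x y
      = 1 / (1 - cpower logq a)
          * Psi1 (cpower logq a) (cpower logp b) (cpower logp c) (cpower logq d) q p x y
        - cpower logq a / (1 - cpower logq a)
          * Psi1 (cpower logq a) (cpower logp b) (cpower logp c) (cpower logq d) q p x (q * y)
        + cpower logq a * x / (1 - cpower logq d)
          * Psi1 (cpower logq (a + 1)) (cpower logp b) (cpower logp c) (cpower logq (d + 1)) q p x (q * y))
    /\
    (cpower logq (d - 1) <> 1 ->
      Psi1 (cpower logq a) (cpower logp b) (cpower logp c) (cpower logq (d - 1)) q p x y
      = Psi1 (cpower logq a) (cpower logp b) (cpower logp c) (cpower logq d) q p x y
        + cpower logq (d - 1) * (1 - cpower logq a) * x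
            / ((1 - cpower logq (d - 1)) * (1 - cpower logq d))
          * Psi1 (cpower logq (a + 1)) (cpower logp b) (cpower logp c) (cpower logq (d + 1)) q p x y))
  /\
  (forall a b c : C,
    (forall n : nat, cpower logp b <> cpower logp (- INR n)) ->
    (forall n : nat, cpower logq c <> cpower logq (- INR n)) ->
    (cpower logq a <> 1 ->
      Psi2 (cpower logq (a + 1)) (cpower logp b) (cpower logq c) q p x y
      = Psi2 (cpower logq a) (cpower logp b) (cpower logq c) q p x y
        + cpower logq a * x / (1 - cpower logq c)
          * Psi2 (cpower logq (a + 1)) (cpower logp b) (cpower logq (c + 1)) q p x y
        + cpower logq a / (1 - cpower logq a)
          * Psi2 (cpower logq a) (cpower logp b) (cpower logq c) q p (q * x) y
        - cpower logq a / (1 - cpower logq a)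
          * Psi2 (cpower logq a) (cpower logp b) (cpower logq c) q p (q * x) (q * y)
      /\
      Psi2 (cpower logq (a + 1)) (cpower logp b) (cpower logq c) q p x y
      = 1 / (1 - cpower logq a)
          * Psi2 (cpower logq a) (cpower logp b) (cpower logq c) q p x y
        - cpower logq a / (1 - cpower logq a)
          * Psi2 (cpower logq a) (cpower logp b) (cpower logq c) q p x (q * y)
        + cpower logq a * x / (1 - cpower logq c)
          * Psi2 (cpower logq (a + 1)) (cpower logp b) (cpower logq (c + 1)) q p x (q * y))
    /\
    (cpower logq (c - 1) <> 1 ->
      Psi2 (cpower logq a) (cpower logp b) (cpower logq (c - 1)) q p x y
      = Psi2 (cpower logq a) (cpower logp b) (cpower logq c) q p x y
        + cpower logq (c - 1) * (1 - cpower logq a) * x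
            / ((1 - cpower logq (c - 1)) * (1 - cpower logq c))
          * Psi2 (cpower logq (a + 1)) (cpower logp b) (cpower logq (c + 1)) q p x y)).
Proof.
intros q p logq logp x y Eq Ep Hq Hp Hx Hy.
(* Both parts are instances of one statement with [A], [B], [E] arbitrary; only [D] stays a power,
   because d - 1 must make sense. *)
assert (main : forall A B E d : C,
  (forall m, 1 - E * p ^ m <> 0) ->
  (forall n : nat, cpower logq d <> cpower logq (- INR n)) ->
  let D := cpower logq d in
  (A <> 1 ->
    Psi1 (q * A) B E D q p x y
    = Psi1 A B E D q p x y
      + A * x / (1 - D) * Psi1 (q * A) B E (q * D) q p x y
      + A / (1 - A) * Psi1 A B E D q p (q * x) y
      - A / (1 - A) * Psi1 A B E D q p (q * x) (q * y)
    /\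
    Psi1 (q * A) B E D q p x y
    = 1 / (1 - A) * Psi1 A B E D q p x y
      - A / (1 - A) * Psi1 A B E D q p x (q * y)
      + A * x / (1 - D) * Psi1 (q * A) B E (q * D) q p x (q * y))
  /\
  (cpower logq (d - 1) <> 1 ->
    Psi1 A B E (cpower logq (d - 1)) q p x y
    = Psi1 A B E D q p x y
      + cpower logq (d - 1) * (1 - A) * x / ((1 - cpower logq (d - 1)) * (1 - D))
        * Psi1 (q * A) B E (q * D) q p x y)).
{ intros A B E d HE Hd D.
  assert (HD : forall m, 1 - D * q ^ m <> 0).
  { rewrite <- Eq; apply cpower_nonsingular, Hd. }
  split.
  - intros HA; split.
    + apply Psi1_raise_A_1; auto using one_minus_neq_0.
    + apply Psi1_raise_A_2; auto using one_minus_neq_0.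
  - intros Hd1.
    (* [Psi1_lower_D] is applied at q^(d-1), so [D] is rewritten as [q] times that power. *)
    assert (ED : D = q * cpower logq (d - 1)).
    { rewrite <- Eq; apply cpower_minus_1. }
    rewrite ED in *.
    apply Psi1_lower_D; auto using lowered_nonsingular. }
split.
- intros a b c d Hc Hd.
  rewrite !cpower_plus_1, Eq.
  apply main; [|exact Hd].
  rewrite <- Ep; apply cpower_nonsingular, Hc.
- intros a b c Hb Hc.
  rewrite !cpower_plus_1, Eq, !Psi2_Psi1.
  apply main; [|exact Hc].
  rewrite <- Ep; apply cpower_nonsingular, Hb.
Qed.
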